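(* For a finite group $R$, let $\mathrm{CD}(R)$ be a set of representatives of the isomorphism classes of the digraphs $\{\Gamma(R,S)\mid S\subseteq R\}$, and let $\mathrm{DRR}(R)$ be the set of elements of $\mathrm{CD}(R)$ that are DRRs. Then $|\mathrm{DRR}(R)|/|\mathrm{CD}(R)|\to 1$ as $|R|\to\infty$; that is, for every $\delta>0$ there is $r_0$ such that $|\mathrm{DRR}(R)|/|\mathrm{CD}(R)|\ge 1-\delta$ for every finite group $R$ with $|R|\ge r_0$.
   Context: For a finite group $R$ and $S\subseteq R$, the Cayley digraph $\Gamma(R,S)$ has vertex set $R$ and $(g,h)$ is an arc iff $hg^{-1}\in S$ (loops allowed). Identifying $R$ with its right regular representation, $\Gamma(R,S)$ is a DRR if $\mathrm{Aut}(\Gamma(R,S))=R$. Digraph isomorphism is a bijection of vertex sets mapping arcs onto arcs. *)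

(* Defs.v *)
From mathcomp Require Import all_boot all_fingroup.

Set Implicit Arguments.
Unset Strict Implicit.
Unset Printing Implicit Defensive.

Local Open Scope group_scope.

(* A digraph with vertex set T is given by its set of arcs; loops are allowed,
   so every subset of T * T is a digraph. *)
Definition digraph (T : finType) := {set T * T}.

Definition map_arcs (T : finType) (p : {perm T}) (G : digraph T) : digraph T :=
  [set (p a.1, p a.2) | a in G].

Definition digraph_iso (T : finType) (G H : digraph T) : bool :=
  [exists p : {perm T}, map_arcs p G == H].

Definition digraph_aut (T : finType) (G : digraph T) : {set {perm T}} :=
  [set p : {perm T} | map_arcs p G == G].

Definition cayley (R : finGroupType) (S : {set R}) : digraph R :=
  [set a : R * R | a.2 * a.1^-1 \in S].

Definition cayley_digraphs (R : finGroupType) : {set digraph R} :=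
  [set cayley S | S : {set R}].

(* The permutations g |-> g * x of R, for x in R. *)
Definition right_regular (R : finGroupType) : {set {perm R}} :=
  [set actperm 'R%act x | x : R].

Definition is_DRR (R : finGroupType) (G : digraph R) : bool :=
  digraph_aut G == right_regular R.

Definition is_CD (R : finGroupType) (CD : {set digraph R}) : bool :=
  is_transversal CD (equivalence_partition (@digraph_iso R) (cayley_digraphs R))
    (cayley_digraphs R).

Definition DRR (R : finGroupType) (CD : {set digraph R}) : {set digraph R} :=
  [set G in CD | is_DRR G].

Lemma map_arcs1 (T : finType) (G : digraph T) : map_arcs 1 G = G.
Proof.
rewrite /map_arcs -[RHS]imset_id; apply: eq_imset => -[x y] /=.
by rewrite !perm1.
Qed.

Lemma map_arcsM (T : finType) (p q : {perm T}) (G : digraph T) :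
  map_arcs (p * q) G = map_arcs q (map_arcs p G).
Proof.
rewrite /map_arcs -imset_comp; apply: eq_imset => -[x y] /=.
by rewrite !permM.
Qed.

Lemma digraph_iso_equiv (T : finType) : equivalence_rel (@digraph_iso T).
Proof.
apply/equivalence_relP; split=> [G | G H /existsP[p /eqP <-] K].
  by apply/existsP; exists 1; rewrite map_arcs1.
apply/existsP/existsP => -[q /eqP <-].
  by exists (p^-1 * q); rewrite -map_arcsM mulKVg.
by exists (p * q); rewrite map_arcsM.
Qed.

(* Main.v *)
(* Let r = |R|, let p be an automorphism of the digraph of S that is not a right
   translation, and write p a = a (u a). For all x and b,
     x b^-1 \in S  iff  p x (p b)^-1 \in S,
   and the two elements coincide iff u x = u b. If u does not take a single value
   outside a set of fewer than m points, there are large P and Q with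
   u P and u Q disjoint; picking m points of P, then greedily m points of Q such
   that all quotients x b^-1 are distinct, yields m^2 nontrivial ties on S. They
   leave at most 2^(r - m^2 / 2) choices for S, while there are only r^(4 m) choices
   for the points and their images. If u = v off fewer than m points, then for some
   t != 1 membership in S is invariant under a |-> a t off fewer than m points, and
   the same count applies. With m = 10 L and r < 2^L this leaves at most
   2^(r - 10 L^2 + 1) sets S for which the digraph is not a DRR.

   An isomorphism between two DRRs normalizes R, so an isomorphism class of DRRs
   comes from at most |Aut R| <= r^L <= 2^(L^2) sets S; hence DRR(R) has at least
   2^(r - 1 - L^2) elements, which dominates the above number. *)

Require Import Defs.
From mathcomp Require Import all_boot all_order all_algebra all_fingroup.
From mathcomp Require Import reals zify.

Set Implicit Arguments.
Unset Strict Implicit.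
Unset Printing Implicit Defensive.

Local Open Scope nat_scope.

(** * Union bound and sets subject to ties *)

Lemma leq_card_bigcup (I T : finType) (P : pred I) (F : I -> {set T}) c :
  (forall i, P i -> #|F i| <= c) -> #|\bigcup_(i | P i) F i| <= #|I| * c.
Proof.
move=> leFc; apply: (@leq_trans (\sum_(i | P i) c)); last first.
  by rewrite sum_nat_const leq_mul2r max_card orbT.
apply: (@leq_trans (\sum_(i | P i) #|F i|)); last exact: leq_sum.
elim/big_rec2: _ => [|i n A _ leAn]; first by rewrite cards0.
by rewrite (leq_trans (leq_card_setU _ _)) // leq_add2l.
Qed.

Definition tied (T : finType) (D : {set T}) (f : T -> T) : {set {set T}} :=
  [set S : {set T} | [forall a in D, (a \in S) == (f a \in S)]].

Lemma tiedP (T : finType) (D S : {set T}) (f : T -> T) :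
  reflect {in D, forall a, (a \in S) = (f a \in S)} (S \in tied D f).
Proof.
rewrite inE; apply: (iffP 'forall_implyP) => H a Da; first exact/eqP/H.
exact/eqP/H.
Qed.

(** Membership of a point of [D] is read off its image, which has smaller rank; by induction on
    [rho], [S :\: D] determines [S]. *)
Lemma card_tied_decreasing (T : finType) (D : {set T}) f (rho : T -> nat) :
  {in D, forall a, rho (f a) < rho a} -> #|tied D f| <= 2 ^ #|~: D|.
Proof.
move=> rhoD; rewrite -card_powerset.
rewrite -[leqLHS](@card_in_imset _ _ (fun S => S :\: D)).
  apply/subset_leq_card/subsetP=> _ /imsetP[S _ ->].
  by rewrite inE setDE subsetIr.
move=> S S' /tiedP tS /tiedP tS' eqSS'; apply/setP=> a.
have [n] := ubnP (rho a); elim: n a => // n IHn a lean.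
have [Da | D'a] := boolP (a \in D).
  by rewrite tS // tS' // IHn // (leq_trans (rhoD _ Da)).
by have /setP/(_ a) := eqSS'; rewrite !inE D'a.
Qed.

(* Along a total order on [T], at least half of the ties point the same way,
   and then the trace of [S] outside their sources determines [S]. *)
Lemma card_tied (T : finType) (D : {set T}) f k :
  {in D, forall a, f a != a} -> k.*2 <= #|D| -> #|tied D f| <= 2 ^ (#|T| - k).
Proof.
move=> fD lekD.
pose rk (a : T) : nat := enum_rank a.
pose up := [set a in D | rk a < rk (f a)].
pose dn := [set a in D | rk (f a) < rk a].
have leD (E : {set T}) (rho : T -> nat) : E \subset D -> k <= #|E| ->
    {in E, forall a, rho (f a) < rho a} -> #|tied D f| <= 2 ^ (#|T| - k).
  move=> sED lekE /card_tied_decreasing leE.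
  apply: (@leq_trans #|tied E f|).
    apply/subset_leq_card/subsetP=> S /tiedP tS; apply/tiedP=> a Ea.
    by apply: tS; apply: (subsetP sED).
  apply: leq_trans leE _.
  by rewrite leq_exp2l // cardsCs setCK leq_sub2l.
have leDud : #|D| <= #|up| + #|dn|.
  apply: leq_trans (leq_card_setU up dn); apply/subset_leq_card/subsetP=> a Da.
  rewrite !inE Da /=; case: ltngtP => // /val_inj/enum_rank_inj fa.
  by have := fD a Da; rewrite -fa eqxx.
have [leku | ltuk] := leqP k #|up|.
  (* Ties pointing upwards decrease the reversed rank. *)
  apply: (leD up (fun a => #|T| - rk a)) => // [|a].
    by apply/subsetP=> a; rewrite inE => /andP[].
  rewrite inE => /andP[_ lta]; apply: ltn_sub2l => //.
  exact: leq_trans lta (ltnW (ltn_ord _)).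
apply: (leD dn rk) => [||a]; last by rewrite inE => /andP[].
  by apply/subsetP=> a; rewrite inE => /andP[].
move: lekD leDud ltuk; lia.
Qed.

(** * Choosing points with many distinct quotients *)

Lemma set_ffun (T : finType) (A : {set T}) m : A != set0 -> #|A| <= m ->
  exists g : {ffun 'I_m -> T}, [set g i | i : 'I_m] = A.
Proof.
(* [x0] fills the positions beyond [enum A], so sets of at most [m] points are all covered by the
   [#|T| ^ m] functions. *)
case/set0Pn=> x0 Ax0 leAm; exists [ffun i : 'I_m => nth x0 (enum A) i].
apply/setP=> a; apply/imsetP/idP=> [[i _ ->] | Aa].
  rewrite ffunE; have [lti | gei] := ltnP i (size (enum A)).
    by rewrite -mem_enum mem_nth.
  by rewrite nth_default.
have lta : index a (enum A) < m.
  by rewrite (leq_trans _ leAm) // cardE index_mem mem_enum.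
by exists (Ordinal lta); rewrite // ffunE /= nth_index // mem_enum.
Qed.

(** Let [V] be a smallest set of values whose preimage has at least [m] points. If fewer than [M]
    points lie outside this preimage, then, as removing some [v] from [V] leaves fewer than [m]
    points, the fibre of [v] alone has at least [M]. *)
Lemma separating_sets (T U : finType) (u : T -> U) m M :
    (forall v, m <= #|[set x | u x != v]|) -> M + M + m <= #|T| ->
  exists P Q : {set T}, [/\ m <= #|P|, M <= #|Q|
    & forall x y, x \in P -> y \in Q -> u x != u y].
Proof.
move=> manyu leMT.
have leT : m <= #|u @^-1: setT|.
  by rewrite preimsetT cardsT; move: leMT; lia.
case: (@arg_minnP _ setT (fun V : {set U} => m <= #|u @^-1: V|)
        (fun V => #|V|) leT) => V leV minV.
have [leMQ | ltQM] := leqP M #|~: (u @^-1: V)|.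
  exists (u @^-1: V), (~: (u @^-1: V)); split=> // x y.
  by rewrite !inE => Vx; apply: contraNneq => <-.
have cardV : #|u @^-1: V| + #|~: (u @^-1: V)| = #|T| by rewrite cardsC.
have [V0 | [v Vv]] := set_0Vmem V.
  move: cardV ltQM; rewrite V0 preimset0 cards0; move: leMT; lia.
have ltVv : #|u @^-1: (V :\ v)| < m.
  rewrite ltnNge; apply/negP=> /minV.
  by rewrite (cardsD1 v V) Vv add1n ltnn.
exists [set x | u x != v], [set x | u x == v]; split=> // [|x y].
  have : #|u @^-1: V| <= #|u @^-1: (V :\ v)| + #|[set x | u x == v]|.
    apply: leq_trans (leq_card_setU _ _); apply/subset_leq_card/subsetP=> x.
    by rewrite !inE; case: eqP => // _ ->.
  move: ltVv ltQM cardV leMT; lia.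
by rewrite !inE => uxv /eqP->.
Qed.

Section Product.

Variable R : finGroupType.
Implicit Types X B Q : {set R}.

Lemma leq_card_mulg X B : #|(X * B)%g| <= #|X| * #|B|.
Proof.
rewrite -cardsX; apply: leq_trans (leq_imset_card (fun p => p.1 * p.2)%g _).
apply/subset_leq_card/subsetP=> _ /mulsgP[x b Xx Bb ->].
by apply/imsetP; exists (x, b); rewrite ?inE ?Xx.
Qed.

(** Greedy choice: [X :* b^-1] is disjoint from [X * B^-1] as soon as [b] avoids [B * (X^-1 * X)],
    which has at most [#|B| * #|X| ^ 2] elements. *)
Lemma exists_large_quotient X Q k : X != set0 -> k * #|X| ^ 2 < #|Q| ->
  exists B, [/\ B \subset Q, #|B| = k & k * #|X| <= #|(X * B^-1)%g|].
Proof.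
move=> X0; elim: k => [|k IHk] ltQ.
  by exists set0; rewrite sub0set cards0.
have [|B [sBQ cardB leXB]] := IHk.
  by rewrite (leq_ltn_trans _ ltQ) // leq_mul2r leqnSn orbT.
have: ~~ (Q \subset B * (X^-1 * X))%g.
  apply: contraL ltQ => /subset_leq_card leQ; rewrite -leqNgt.
  apply: leq_trans leQ _; apply: leq_trans (leq_card_mulg _ _) _.
  rewrite cardB leq_mul // (leq_trans (leq_card_mulg _ _)) //.
  by rewrite card_invg.
case/subsetPn=> b Qb BXb; exists (b |: B).
have B'b : b \notin B.
  apply: contra BXb => Bb; have [x Xx] := set0Pn _ X0.
  rewrite -[b]mulg1 -(mulVg x); apply: mem_mulg => //.
  by rewrite mem_mulg // memV_invg.
split; first by rewrite subUset sub1set Qb.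
  by rewrite cardsU1 B'b cardB.
have ->: (X * (b |: B)^-1 = X * B^-1 :|: X :* b^-1)%g.
  by rewrite setUC invUg mulgU invg_set1.
rewrite cardsU disjoint_setI0 ?cards0 ?subn0 ?card_rcoset.
  by rewrite mulSn addnC leq_add2r.
rewrite -setI_eq0; apply/set0Pn=> -[_ /setIP[/mulsgP[x c Xx Bc ->] /rcosetP[y Yy]]].
move/(congr1 (fun z => z^-1 * y)%g); rewrite !invMg !invgK mulgKV -mulgA => eb.
case/negP: BXb; rewrite -eb; apply: mem_mulg; rewrite -?mem_invg //.
by rewrite mem_mulg // memV_invg.
Qed.

End Product.

(** * Ties forced by automorphisms that are not translations *)

Lemma mem_map_arcs (T : finType) (p : {perm T}) (G : digraph T) x y :
  ((p x, p y) \in map_arcs p G) = ((x, y) \in G).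
Proof.
rewrite /map_arcs (mem_imset (f := fun a => (p a.1, p a.2)) _ (x, y)) //.
by move=> [a b] [c d] [] /perm_inj-> /perm_inj->.
Qed.

Lemma map_arcs_inv (T : finType) (p : {perm T}) (G H : digraph T) :
  map_arcs p G = H -> map_arcs p^-1%g H = G.
Proof. by move=> <-; rewrite -map_arcsM mulgV map_arcs1. Qed.

Section NonDRR.

Variable R : finGroupType.
Implicit Types (S : {set R}) (p : {perm R}).

Lemma cayley_autP S p : p \in digraph_aut (cayley S) ->
  forall x y, (p x * (p y)^-1 \in S)%g = (x * y^-1 \in S)%g.
Proof.
rewrite inE => /eqP/setP eqp x y.
by have := eqp (p y, p x); rewrite mem_map_arcs !inE.
Qed.

Lemma map_arcs_translation S x : map_arcs (actperm 'R%act x) (cayley S) = cayley S.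
Proof.
apply/setP=> -[a b].
have tE c : (c * x)%g = actperm 'R%act x c by rewrite actpermE.
rewrite -[a](mulgKV x) -[b](mulgKV x) !tE mem_map_arcs !inE /= -!tE.
by rewrite !mulgKV invMg invgK mulgA mulgKV.
Qed.

Lemma right_regular_sub_aut S : right_regular R \subset digraph_aut (cayley S).
Proof.
by apply/subsetP=> _ /imsetP[x _ ->]; rewrite inE map_arcs_translation.
Qed.

Section Ties.

Variable m : nat.
Implicit Types x b : {ffun 'I_m -> R}.

Definition quotients x b : {set R} :=
  [set (x ij.1 * (b ij.2)^-1)%g | ij : 'I_m * 'I_m].

(** The map sends x b^-1 to p x (p b)^-1, but is built from the points and their images alone, so
    that it can be counted without reference to [p]. *)
Definition quotient_map x b x' b' (a : R) : R :=
  if [pick ij : 'I_m * 'I_m | (x ij.1 * (b ij.2)^-1)%g == a] is Some ij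
  then (x' ij.1 * (b' ij.2)^-1)%g else a.

Lemma quotient_mapP x b x' b' a : a \in quotients x b -> exists i j,
  a = (x i * (b j)^-1)%g /\ quotient_map x b x' b' a = (x' i * (b' j)^-1)%g.
Proof.
rewrite /quotient_map; case: pickP => [[i j] /eqP <- _ | no]; first by exists i, j.
by case/imsetP=> ij _ ea; have := no ij; rewrite ea eqxx.
Qed.

Definition translation_tied (d : R * {ffun 'I_m -> R}) : {set {set R}} :=
  tied (~: [set d.2 i | i : 'I_m]) (fun a => a * d.1)%g.

Definition quotient_tied
    (d : ({ffun 'I_m -> R} * {ffun 'I_m -> R}) *
         ({ffun 'I_m -> R} * {ffun 'I_m -> R})) : {set {set R}} :=
  tied (quotients d.1.1 d.1.2) (quotient_map d.1.1 d.1.2 d.2.1 d.2.2).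

Definition quotient_data d :=
  (m ^ 2 <= #|quotients d.1.1 d.1.2|) &&
  [forall a in quotients d.1.1 d.1.2,
    quotient_map d.1.1 d.1.2 d.2.1 d.2.2 a != a].

Hypothesis m_gt0 : 0 < m.
Hypothesis large_R : (m ^ 3).+1 + (m ^ 3).+1 + m <= #|R|.

Lemma nonDRR_tied :
  [set S : {set R} | ~~ is_DRR (cayley S)]
    \subset (\bigcup_(d | d.1 != 1%g) translation_tied d)
        :|: (\bigcup_(d | quotient_data d) quotient_tied d).
Proof.
apply/subsetP=> S; rewrite inE /is_DRR eqEsubset right_regular_sub_aut andbT.
case/subsetPn=> p Ap Rp; have autS := cayley_autP Ap.
have [u pE] : exists u, forall a, p a = (a * u a)%g.
  by exists (fun a => a^-1 * p a)%g => a; rewrite mulKVg.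
rewrite inE; have [/forallP manyu | ] := boolP [forall v, m <= #|[set a | u a != v]|].
  apply/orP; right.
  have [P [Q [leP leQ uPQ]]] := separating_sets manyu large_R.
  have [X sXP cardX] : exists2 X : {set R}, X \subset P & #|X| = m.
    have [s [us sz sP]] := card_geqP leP.
    exists [set a in s]; first by apply/subsetP=> a; rewrite inE => /sP.
    by rewrite cardsE (card_uniqP us).
  have X0 : X != set0 by rewrite -cards_eq0 cardX -lt0n.
  have [|B [sBQ cardB leXB]] := @exists_large_quotient R X Q m X0.
    (* Here [m * m ^ 2 = m ^ 3 < #|Q|], whence the [(m ^ 3).+1] in [large_R]. *)
    by rewrite cardX -expnS.
  have B0 : B != set0 by rewrite -cards_eq0 cardB -lt0n.
  have [x xE] := set_ffun X0 (eq_leq cardX).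
  have [b bE] := set_ffun B0 (eq_leq cardB).
  have Px i : x i \in P by rewrite (subsetP sXP) // -xE imset_f.
  have Qb i : b i \in Q by rewrite (subsetP sBQ) // -bE imset_f.
  apply/bigcupP; exists ((x, b), ([ffun i => p (x i)], [ffun i => p (b i)])).
    rewrite /quotient_data /=; apply/andP; split.
      rewrite -mulnn -{2}cardX (leq_trans leXB) //.
      apply/subset_leq_card/subsetP=> _ /mulsgP[y c' Xy Bc ->].
      move: Xy Bc; rewrite -xE inE -bE => /imsetP[i _ ->] /imsetP[j _ ec].
      by apply/imsetP; exists (i, j); rewrite //= -ec invgK.
    apply/forall_inP=> a /(@quotient_mapP _ _ [ffun i => p (x i)] [ffun i => p (b i)]).
    (* p x (p b)^-1 = x (u x) (u b)^-1 b^-1, which differs from x b^-1 because [u] separates [P]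
       from [Q]. *)
    case=> i [j [-> ->]]; rewrite !ffunE !pE invMg !mulgA (inj_eq (mulIg _)).
    by rewrite -mulgA -[X in _ != X]mulg1 (inj_eq (mulgI _)) -eq_mulgV1 uPQ.
  apply/tiedP=> a /(@quotient_mapP _ _ [ffun i => p (x i)] [ffun i => p (b i)]).
  by case=> i [j [-> ->]]; rewrite !ffunE autS.
rewrite negb_forall => /existsP[v]; rewrite -ltnNge => ltum.
apply/orP; left.
(* Otherwise [p] would be the right translation by [v]. *)
have [b ub] : exists b : R, u b != v.
  apply/existsP; apply: contraR Rp; rewrite negb_exists => /forallP uv.
  apply/imsetP; exists v => //; apply/permP=> a.
  by rewrite actpermE /= pE; have := uv a; rewrite negbK => /eqP->.
(* If u (a b) = v, applying [autS] to a b and b ties a to a t with t = b v (p b)^-1; the exceptional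
   a form [Y]. Moreover t != 1, since p b = b (u b) differs from b v. *)
pose Y := [set (a * b^-1)%g | a in [set a | u a != v]].
have Y0 : Y != set0
  by apply/set0Pn; exists (b * b^-1)%g; apply/imsetP; exists b; rewrite ?inE.
have [|y yE] := @set_ffun _ Y m Y0.
  exact: leq_trans (leq_imset_card _ _) (ltnW ltum).
apply/bigcupP; exists ((b * v * (p b)^-1)%g, y) => /=.
  by rewrite -eq_mulgV1 pE (inj_eq (mulgI _)) eq_sym.
apply/tiedP=> a; rewrite yE inE => Y'a.
have /eqP uab : u (a * b)%g == v.
  apply: contraR Y'a => uab; apply/imsetP; exists (a * b)%g; rewrite ?inE //.
  by rewrite mulgK.
by have := autS (a * b)%g b; rewrite mulgK pE uab !mulgA.
Qed.


(** [k] and [l] are at most half the numbers of ties in the two cases; the powers of [#|R|] in front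
    count the translation data and the quotient data. *)
Lemma card_nonDRR k l : k.*2 + m <= #|R| -> l.*2 <= m ^ 2 ->
  #|[set S : {set R} | ~~ is_DRR (cayley S)]|
    <= #|R| * #|R| ^ m * 2 ^ (#|R| - k)
       + #|R| ^ m * #|R| ^ m * (#|R| ^ m * #|R| ^ m) * 2 ^ (#|R| - l).
Proof.
move=> lek lel; apply: leq_trans (subset_leq_card nonDRR_tied) _.
apply: leq_trans (leq_card_setU _ _) _; apply: leq_add.
  have -> : #|R| * #|R| ^ m = #|{: R * {ffun 'I_m -> R}}|.
    by rewrite card_prod card_ffun card_ord.
  apply: leq_card_bigcup => -[t y] /= t1; apply: card_tied => [a _|].
    by rewrite -[X in _ != X]mulg1 (inj_eq (mulgI _)).
  have ley : #|[set y i | i : 'I_m]| <= m by rewrite -[leqRHS]card_ord leq_imset_card.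
  by rewrite /= cardsCs setCK leq_subRL ?max_card // addnC (leq_trans _ lek) // leq_add2l.
have -> : #|R| ^ m * #|R| ^ m * (#|R| ^ m * #|R| ^ m) =
    #|{: ({ffun 'I_m -> R} * {ffun 'I_m -> R}) *
         ({ffun 'I_m -> R} * {ffun 'I_m -> R})}|.
  by rewrite !card_prod card_ffun card_ord.
apply: leq_card_bigcup => d /andP[le_m /forall_inP fD].
exact: card_tied fD (leq_trans lel le_m).
Qed.

End Ties.
End NonDRR.

(** * Isomorphism classes of DRRs *)

Section IsoClasses.

Variable R : finGroupType.
Implicit Types (S T : {set R}) (p : {perm R}).

Lemma cayley_inj : injective (@cayley R).
Proof.
move=> S T eST; apply/setP=> a.
by have /setP/(_ (1%g, a)) := eST; rewrite !inE /= invg1 mulg1.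
Qed.

Lemma card_right_regular : #|right_regular R| = #|R|.
Proof.
rewrite card_imset // => x y /permP/(_ 1%g).
by rewrite !actpermE /= !mul1g.
Qed.

(** By Lagrange, a new generator outside the current subgroup at least doubles its order; once the
    subgroup is everything, the list is padded with 1. *)
Lemma exists_generators k : exists s : {ffun 'I_k -> R},
  2 ^ k <= #|<<[set s i | i : 'I_k]>>%g| \/ <<[set s i | i : 'I_k]>>%g = [set: R].
Proof.
elim: k => [|k [s sP]]; first by exists [ffun _ => 1%g]; left; rewrite cardG_gt0.
set H := <<_>>%g in sP.
have [HT | [x _ Hx]] : H = [set: R] \/ exists2 x, x \in [set: R] & x \notin H.
    have [|/subsetPn] := boolP ([set: R] \subset H); last by right.
    by rewrite subTset => /eqP; left.
  exists [ffun i => if unlift ord0 i is Some j then s j else 1%g]; right.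
  apply/eqP; rewrite -subTset -HT; apply/genS/subsetP=> _ /imsetP[i _ ->].
  by apply/imsetP; exists (lift ord0 i); rewrite // ffunE liftK.
exists [ffun i => if unlift ord0 i is Some j then s j else x].
set H' := <<_>>%g.
have sHH' : H \subset H'.
  apply/genS/subsetP=> _ /imsetP[i _ ->].
  by apply/imsetP; exists (lift ord0 i); rewrite // ffunE liftK.
have H'x : x \in H'.
  by apply: mem_gen; apply/imsetP; exists ord0; rewrite // ffunE unlift_none.
left; case: sP => [leH | HT]; last by rewrite HT inE in Hx.
have ind_gt1 : 1 < #|H' : H|%g.
  by rewrite indexg_gt1; apply: contra Hx => /subsetP; apply.
by rewrite -(Lagrange sHH') expnSr leq_mul.
Qed.

Definition automorphisms : {set {perm R}} :=
  [set p : {perm R} | [forall x, forall y, p (x * y)%g == (p x * p y)%g]].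

Lemma automorphismsP p :
  reflect {morph p : x y / (x * y)%g} (p \in automorphisms).
Proof.
rewrite inE; apply: (iffP forallP) => [H x y | H x].
  by have /forallP/(_ y)/eqP := H x.
by apply/forallP=> y; rewrite H.
Qed.

(** Since [2 ^ k] exceeds [#|R|], some [k] elements generate [R], and an automorphism is determined
    by their images. *)
Lemma card_automorphisms k : #|R| < 2 ^ k -> #|automorphisms| <= #|R| ^ k.
Proof.
move=> ltRk; have [s [|gens]] := exists_generators k.
  by rewrite leqNgt (leq_ltn_trans (max_card _) ltRk).
pose f p := [ffun i => p (s i)].
have -> : #|R| ^ k = #|{: {ffun 'I_k -> R}}| by rewrite card_ffun card_ord.
rewrite -[leqLHS](@card_in_imset _ _ f automorphisms); first exact: max_card.
move=> p q /automorphismsP Mp /automorphismsP Mq /ffunP epq; apply/permP=> x.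
have fix1 (r : {perm R}) : {morph r : x y / (x * y)%g} -> r 1%g = 1%g.
  by move=> Mr; apply: (mulgI (r 1%g)); rewrite -Mr !mulg1.
have G_E : group_set [set x : R | p x == q x].
  apply/group_setP; split=> [|y z]; rewrite !inE.
    by rewrite !fix1.
  by rewrite Mp Mq => /eqP-> /eqP->.
have: <<[set s i | i : 'I_k]>>%g \subset group G_E.
  rewrite gen_subG; apply/subsetP=> _ /imsetP[i _ ->].
  by have := epq i; rewrite !ffunE inE => ->.
by rewrite gens => /subsetP/(_ x); rewrite !inE => /(_ isT)/eqP.
Qed.

(* An isomorphism between two DRRs normalizes the right regular representation,
   hence is an automorphism of [R] up to a translation. *)
Lemma DRR_iso_automorphism S T p : is_DRR (cayley S) -> is_DRR (cayley T) ->
  map_arcs p (cayley T) = cayley S ->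
  exists2 q, q \in automorphisms & S = q @: T.
Proof.
move=> /eqP drrS /eqP drrT pTS.
pose q := (p * actperm 'R%act (p 1)^-1)%g.
have qE x : q x = (p x * (p 1)^-1)%g by rewrite permM actpermE.
have qTS : map_arcs q (cayley T) = cayley S.
  by rewrite map_arcsM pTS map_arcs_translation.
exists q.
  apply/automorphismsP=> x y.
  have: (p^-1 * actperm 'R%act y * p)%g \in digraph_aut (cayley S).
    by rewrite inE !map_arcsM (map_arcs_inv pTS) map_arcs_translation pTS.
  rewrite drrS => /imsetP[z _ /permP ez].
  have pM a : p (a * y)%g = (p a * z)%g.
    by have := ez (p a); rewrite !permM permK !actpermE.
  by rewrite !qE pM -[y in RHS]mul1g pM !mulgA mulgKV.
apply/setP=> a; rewrite -[a](permKV q) mem_imset; last exact: perm_inj.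
have q1 : q 1%g = 1%g by rewrite qE mulgV.
have := mem_map_arcs q (cayley T) 1%g (q^-1 a)%g.
by rewrite qTS q1 !inE /= !invg1 !mulg1.
Qed.

(** Conjugation by [p] embeds the automorphism group of [cayley T] into that of [cayley S], which
    has the order of [R]; the former already contains the right translations. *)
Lemma DRR_iso S T p : map_arcs p (cayley T) = cayley S ->
  is_DRR (cayley S) -> is_DRR (cayley T).
Proof.
move=> pTS /eqP drrS; rewrite /is_DRR eq_sym eqEcard right_regular_sub_aut.
rewrite -drrS -[leqLHS](card_imset _ (conjg_inj p)) /=.
apply/subset_leq_card/subsetP.
move=> _ /imsetP[q + ->]; rewrite inE => /eqP qT.
by rewrite inE conjgE !map_arcsM (map_arcs_inv pTS) qT pTS.
Qed.

Variable CD : {set digraph R}.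
Hypothesis CDP : is_CD CD.

Lemma CD_sub G : G \in CD -> exists S, G = cayley S.
Proof.
have /and3P[_ /subsetP sCD _] := CDP.
by move/sCD/imsetP=> [S _ ->]; exists S.
Qed.

Lemma CD_represents S : exists2 T, cayley T \in CD &
  exists p, map_arcs p (cayley T) = cayley S.
Proof.
have cS : cayley S \in cayley_digraphs R by apply: imset_f.
have /and3P[_ _ /forallP] := CDP.
move/(_ [set G in cayley_digraphs R | digraph_iso (cayley S) G]).
have -> /= : [set G in cayley_digraphs R | digraph_iso (cayley S) G]
    \in equivalence_partition (@digraph_iso R) (cayley_digraphs R).
  by apply/imsetP; exists (cayley S).
case/cards1P=> G /setP/(_ G); rewrite !inE eqxx => /andP[CDG /andP[_]].
have [T eT] := CD_sub CDG.
rewrite eT => /existsP[p /eqP pST]; exists T; first by rewrite -eT.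
by exists p^-1%g; apply: map_arcs_inv.
Qed.

Lemma card_nonDRR_CD :
  #|CD :\: DRR CD| <= #|[set S : {set R} | ~~ is_DRR (cayley S)]|.
Proof.
rewrite -[leqRHS](card_imset _ cayley_inj); apply/subset_leq_card/subsetP=> G.
rewrite !inE => /andP[nDRR CDG]; have [S eS] := CD_sub CDG.
apply/imsetP; exists S => //; rewrite inE -eS.
by apply: contra nDRR => ->; rewrite CDG.
Qed.

Lemma card_DRR_sets :
  #|[set S : {set R} | is_DRR (cayley S)]| <= #|DRR CD| * #|automorphisms|.
Proof.
rewrite -cardsX.
(* The connection set is recovered from its digraph as the set of out-neighbours of 1. *)
pose f (Gq : digraph R * {perm R}) : {set R} :=
  Gq.2 @: [set x | (1%g, x) \in Gq.1].
apply: leq_trans (leq_imset_card f _); apply/subset_leq_card/subsetP=> S.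
rewrite inE => drrS; have [T CDT [p pTS]] := CD_represents S.
have drrT := DRR_iso pTS drrS.
have [q Aq eS] := DRR_iso_automorphism drrS drrT pTS.
apply/imsetP; exists (cayley T, q).
  by rewrite in_setX /= Aq andbT inE CDT drrT.
rewrite eS /f /=; suff -> : [set x | (1%g, x) \in cayley T] = T by [].
by apply/setP=> x; rewrite !inE /= invg1 mulg1.
Qed.

End IsoClasses.

(** * Numerical estimates *)

Lemma cube_le_exp2 L : 30 <= L -> 3000 * L ^ 3 <= 2 ^ L.-1.
Proof.
elim: L => // L IHL; rewrite leq_eqVlt => /predU1P[<- | leL].
  apply: (@leq_trans (2 ^ 12 * (2 ^ 5) ^ 3)); first by rewrite leq_mul // leq_exp2r.
  by rewrite -expnM -expnD leq_exp2l.
rewrite ltnS in leL; apply: leq_trans (_ : 2 * (3000 * L ^ 3) <= _).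
  rewrite mulnCA leq_mul2l /=.
  have leLL : 30 * L <= L * L by rewrite leq_mul2r leL orbT.
  have leLLL : 30 * (L * L) <= L * (L * L) by rewrite leq_mul2r leL orbT.
  rewrite !expnS expn0 !muln1; move: leL leLL leLLL; nia.
case: L leL IHL => // L leL IHL; rewrite [leqRHS]expnS leq_mul2l /=.
exact: IHL.
Qed.

(** To be read with [r] the order of the group, [a] and [n] the numbers of DRRs and of other
    digraphs in [CD], [N] the number of sets whose digraph is not a DRR, and [A] the number of
    automorphisms. *)
Lemma DRR_domination L r a n N A : 30 <= L -> 2 ^ L.-1 <= r -> r < 2 ^ L ->
    n <= N -> A <= r ^ L -> 2 ^ r <= a * A + N ->
    (forall k l, let m := 10 * L in
       0 < m -> (m ^ 3).+1 + (m ^ 3).+1 + m <= r ->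
       k.*2 + m <= r -> l.*2 <= m ^ 2 ->
       N <= r * r ^ m * 2 ^ (r - k)
            + r ^ m * r ^ m * (r ^ m * r ^ m) * 2 ^ (r - l)) ->
  0 < a /\ n * r <= a.
Proof.
move=> leL lebr ltrb lenN leA le2r leN.
have le_cube := leq_trans (cube_le_exp2 leL) lebr.
have leLL : 30 * L <= L * L by rewrite leq_mul2r leL orbT.
have leLLL : 30 * (L * L) <= L * (L * L) by rewrite leq_mul2r leL orbT.
have cubeE : L ^ 3 = L * (L * L) by rewrite !expnS expn0 muln1.
have leX j : r ^ j <= 2 ^ (L * j).
  by case: j => [|j]; rewrite ?muln0 //  expnM leq_exp2r // ltnW.
have {leN}leN : N <= 2 ^ (r - 10 * (L * L) + 1).
  (* With m = 10 L, the counting factors are at most 2^(10 L^2 + L) and 2^(40 L^2); ties worth 21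
     L^2 and 50 L^2 = m^2 / 2 bring both terms below 2^(r - 10 L^2). *)
  apply: leq_trans (leN (21 * (L * L)) (50 * (L * L)) _ _ _ _) _.
  - by move: leL; lia.
  (* 2 m^3 + m + 2 = 2000 L^3 + 10 L + 2 is at most 3000 L^3. *)
  - rewrite expnMn cubeE; move: le_cube; rewrite cubeE; lia.
  - by move: le_cube; rewrite cubeE; lia.
  - by rewrite expnMn -mulnn; lia.
  rewrite addn1 expnS mul2n -addnn; apply: leq_add.
    rewrite -expnS; apply: leq_trans (leq_mul (leX _) (leqnn _)) _.
    by rewrite -expnD leq_exp2l //; move: le_cube; rewrite cubeE; nia.
  rewrite -!expnD; apply: leq_trans (leq_mul (leX _) (leqnn _)) _.
  by rewrite -expnD leq_exp2l //; move: le_cube; rewrite cubeE; nia.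
(* At least half of all sets give DRRs, and each class accounts for at most 2^(L^2) of them. *)
have lea : 2 ^ r.-1 <= a * 2 ^ (L * L).
  have leA2 : a * A <= a * 2 ^ (L * L).
    by rewrite leq_mul2l (leq_trans leA (leX L)) orbT.
  have leN2 : N <= 2 ^ r.-1.
    apply: leq_trans leN _; rewrite leq_exp2l //.
    by move: le_cube; rewrite cubeE; lia.
  have r_gt0 : 0 < r by move: le_cube; rewrite cubeE; lia.
  have er : 2 ^ r = 2 ^ r.-1 + 2 ^ r.-1 by rewrite -{1}(prednK r_gt0) expnS mul2n addnn.
  move: le2r leA2 leN2; rewrite er; lia.
split.
  by case: (posnP a) lea => // ->; rewrite leqn0 expn_eq0.
have pos : 0 < 2 ^ (L * L) by rewrite expn_gt0.
rewrite -(leq_pmul2r pos); apply: leq_trans lea.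
apply: (@leq_trans (2 ^ (r - 10 * (L * L) + 1) * 2 ^ L * 2 ^ (L * L))).
  by rewrite leq_mul2r leq_mul ?orbT ?(leq_trans lenN) // ltnW.
rewrite -!expnD leq_exp2l //; move: le_cube; rewrite cubeE; lia.
Qed.

(** * Passage to the limit *)

Lemma nonDRR_negligible : exists r0, forall R : finGroupType, r0 <= #|R| ->
  forall CD : {set digraph R}, is_CD CD ->
    0 < #|DRR CD| /\ #|CD :\: DRR CD| * #|R| <= #|DRR CD|.
Proof.
exists (2 ^ 30) => R leR CD CDP.
have R_gt0 : 0 < #|R| by apply: leq_trans leR; rewrite expn_gt0.
(* Thus [2 ^ L.-1 <= #|R| < 2 ^ L], and [2 ^ 30 <= #|R|] gives [30 < L]. *)
pose L := (trunc_log 2 #|R|).+1.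
have ltRL : #|R| < 2 ^ L by apply: trunc_log_ltn.
apply: (@DRR_domination L _ _ _ #|[set S : {set R} | ~~ is_DRR (cayley S)]|
          #|automorphisms R|) => //.
- by apply: ltnW; rewrite ltnS; apply: trunc_log_max.
- exact: trunc_logP.
- exact: card_nonDRR_CD.
- exact: card_automorphisms.
- apply: leq_trans (leq_add (card_DRR_sets CDP) (leqnn _)).
  have <- : #|[set: {set R}]| = 2 ^ #|R| by rewrite -powersetT card_powerset cardsT.
  rewrite cardsT -(cardsC [set S : {set R} | is_DRR (cayley S)]) leq_add2l.
  by apply/subset_leq_card/subsetP=> S; rewrite !inE.
move=> k l m m0 leR' lek lel; exact: card_nonDRR.
Qed.

Import Order.TTheory GRing.Theory Num.Theory.
Local Open Scope ring_scope.

Theorem theorem1p5 (K : realType) (delta : K) (delta_gt0 : 0 < delta) :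
  exists r0 : nat, forall R : finGroupType, (r0 <= #|R|)%N ->
    forall CD : {set digraph R}, is_CD CD ->
      1 - delta <= #|DRR CD|%:R / #|CD|%:R.
Proof.
have [r0 r0P] := nonDRR_negligible.
(* The second bound gives 1 <= delta |R|, so the non-DRRs, at most a 1 / |R| fraction of [CD], are
   at most a delta fraction. *)
exists (maxn r0 (Num.bound delta^-1)) => R; rewrite geq_max => /andP[le_r0 leb] CD CDP.
have [a_gt0 lea] := r0P R le_r0 CD CDP.
have cardCD : #|CD| = (#|DRR CD| + #|CD :\: DRR CD|)%N.
  rewrite -(cardsID (DRR CD) CD) (setIidPr _) //.
  by apply/subsetP=> G; rewrite inE => /andP[].
have dr : 1 <= delta * #|R|%:R.
  rewrite -ler_pdivrMl // mulr1.
  apply: le_trans (ltW (archi_boundP _)) _; first by rewrite invr_ge0 ltW.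
  by rewrite ler_nat.
have c_gt0 : (0 < #|CD|%:R :> K) by rewrite ltr0n cardCD addn_gt0 a_gt0.
rewrite ler_pdivlMr // mulrBl mul1r lerBlDr {1}cardCD natrD lerD2l.
apply: (@le_trans _ _ (delta * #|R|%:R * #|CD :\: DRR CD|%:R)).
  by rewrite ler_peMl.
rewrite -mulrA ler_pM2l // -natrM ler_nat mulnC (leq_trans lea) // cardCD.
exact: leq_addr.
Qed.
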